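(* There is an absolute constant $c>0$ such that for all integers $n>1$ and $1<k\le\binom{n-1}{\lfloor(n-1)/2\rfloor}$, $C_{\mathrm{NGBW}}(n,k)\ge(cnk)^n$; that is, $C_{\mathrm{NGBW}}(n,k)=(\Omega(nk))^n$.
   Context: An NGBW is $(\Sigma,S,I,\Delta,\{F_1,\dots,F_k\})$ with finite alphabet, finite state set $S$, $I\subseteq S$, $\Delta\subseteq S\times\Sigma\times S$, $F_i\subseteq S$; $k$ is its index. A run over $\alpha\in\Sigma^\omega$ is $\rho(0)\rho(1)\cdots$ with $\rho(0)\in I$, $\langle\rho(i),\alpha(i),\rho(i+1)\rangle\in\Delta$; it is successful if each $F_i$ contains a state occurring infinitely often in $\rho$; $\mathcal{L}(\mathcal{A})$ is the set of $\omega$-words with a successful run. $C_{\mathrm{NGBW}}(\mathcal{A})$ is the minimum number of states of an NGBW over $\Sigma$ accepting $\Sigma^\omega\setminus\mathcal{L}(\mathcal{A})$, and $C_{\mathrm{NGBW}}(n,k)$ is the maximum of $C_{\mathrm{NGBW}}(\mathcal{A})$ over NGBWs $\mathcal{A}$ with $n$ states and index $k$. *)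

(* Defs.v *)
From HB Require Import structures.
From mathcomp Require Import all_boot all_order all_algebra.
From mathcomp Require Import all_classical all_reals ereal.

Set Implicit Arguments.
Unset Strict Implicit.
Unset Printing Implicit Defensive.

Import Order.TTheory GRing.Theory Num.Theory.

Local Open Scope classical_set_scope.
Local Open Scope ring_scope.

Record ngbw (Sigma : finType) : Type := Ngbw {
  state : finType;
  init : {set state};
  trans : {set state * Sigma * state};
  acc : {set {set state}} }.

(* The acceptance condition is a set of sets of states, so the index counts
   distinct sets. *)
Definition ngbw_index (Sigma : finType) (A : ngbw Sigma) : nat := #|acc A|.

Definition is_run (Sigma : finType) (A : ngbw Sigma)
    (alpha : nat -> Sigma) (rho : nat -> state A) : Prop :=
  rho 0%N \in init A /\
  forall i : nat, (rho i, alpha i, rho i.+1) \in trans A.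

Definition successful (Sigma : finType) (A : ngbw Sigma)
    (rho : nat -> state A) : Prop :=
  forall F : {set state A}, F \in acc A ->
    exists2 q : state A, q \in F & infinite_set [set i : nat | rho i = q].

Definition language (Sigma : finType) (A : ngbw Sigma) : set (nat -> Sigma) :=
  [set alpha | exists2 rho : nat -> state A, is_run alpha rho & successful rho].

(* The minimum and the maximum in the two definitions below are taken in the
   extended reals.  They agree with the minimum and the maximum of a set of
   natural numbers whenever these exist (which they do, by Buechi's
   complementation theorem and the known upper bounds). *)
Definition C_NGBW_of (R : realType) (Sigma : finType) (A : ngbw Sigma) :
    \bar R :=
  ereal_inf [set x : \bar R | exists2 B : ngbw Sigma,
    language B = ~` language A & x = (#|state B|%:R)%:E].

(* The alphabet is not fixed: the maximum ranges over all finite alphabets. *)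
Definition C_NGBW (R : realType) (n k : nat) : \bar R :=
  ereal_sup [set x : \bar R | exists (Sigma : finType) (A : ngbw Sigma),
    [/\ #|state A| = n, ngbw_index A = k & x = C_NGBW_of R A]].

(* Main.v *)
(** The automaton has a state set [Q] of size [m = n - 1] and one more state, the
hub, which lies in no acceptance set.  Its acceptance sets form an antichain of
[k] subsets of [Q] of size [m / 2], chosen so that every state is outside of at
least [k / 2] of them.  A level ranking assigns to the states distinct ranks and,
to each state [p], an acceptance set [J p] not containing [p].  The ranking
allows an excursion from [p] to [q] through [v] if the rank decreases, or if
[p = q] and [v] is not in [J p].  A word of allowed excursions is rejected: the
state of a run is eventually constant, say [p], and then [J p] is not visited.
For two different rankings, a word containing infinitely often the allowed
excursions of both is accepted: either two states [p], [q] are ordered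
differently, and a run may go back and forth between them through any state; or [J p] and
[J' p] differ for some [p], and no acceptance set is included in both.  As in
Michel's argument, an automaton for the complement must thus separate the
[m! (k/2)^m] rankings by its states, as otherwise two of its runs could be
spliced.  A factor [n k] is lost by using only [m] states, but [n] and [k] are at
most [2^m]. *)

Require Import Defs.
From mathcomp Require Import all_boot all_order all_algebra perm zify.
From mathcomp Require Import all_classical all_reals ereal.

Set Implicit Arguments.
Unset Strict Implicit.
Unset Printing Implicit Defensive.

(** * Numerical estimates *)

Lemma bin_le_expn (n i : nat) : 'C(n, i) <= 2 ^ n.
Proof.
have [lt_ni|le_in] := ltnP n i; first by rewrite bin_small.
have lt_i : i < n.+1 by [].
rewrite -[2](addn1 1) expnDn (bigD1 (Ordinal lt_i)) //=.
by rewrite !exp1n !muln1 leq_addr.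
Qed.

(** The product of the [m] factors from [m + 1] to [2m] dominates [m.+1 ^ m]; it is the central
    binomial times the factorial, and the binomial is at most [4 ^ m]. *)
Lemma expn_succ_le_fact (m : nat) : m.+1 ^ m <= 4 ^ m * m`!.
Proof.
have ffact_ge a b : a.+1 ^ b <= (a + b) ^_ b.
  elim: b => [|b IH]; first by rewrite ffactn0.
  by rewrite addnS ffactnS expnS leq_mul // ltnS leq_addr.
apply: leq_trans (ffact_ge m m) _; rewrite -bin_ffact leq_mul2r; apply/orP; right.
apply: leq_trans (bin_le_expn _ _) _.
by rewrite addnn -mul2n expnM.
Qed.

Lemma expn_nk_le (m k : nat) : 1 < k <= 2 ^ m ->
  (m.+1 * k) ^ m.+1 <= 48 ^ m.+1 * (m`! * k./2 ^ m).
Proof.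
case/andP=> k_gt1 k_le.
have n_le : m.+1 <= 2 ^ m by apply: ltn_expl.
have k3 : k ^ m <= 3 ^ m * k./2 ^ m.
  by rewrite -expnMn; case: (posnP m) => [->//|m_gt0]; rewrite leq_exp2r //; lia.
have nm := expn_succ_le_fact m.
rewrite expnMn !expnSr.
(* The bases 4 and 3 come from [nm] and [k3]; the two powers of 2 bound the spare factors [m.+1] and
   [k]. Together they give 48. *)
apply: (@leq_trans (4 ^ m * m`! * 2 ^ m * (3 ^ m * k./2 ^ m * 2 ^ m))).
  by rewrite !leq_mul.
rewrite -[48]/(4 * 2 * 3 * 2) !expnMn; nia.
Qed.

(** * Uniform families of sets with balanced degrees *)

Section Regular.
Variable T : finType.
Implicit Types (X : {set {set T}}) (p q : T).

Definition deg X p := #|[set F in X | p \in F]|.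

Lemma sum_deg X t : {in X, forall F : {set T}, #|F| = t} -> \sum_p deg X p = #|X| * t.
Proof.
move=> Xt; transitivity (\sum_p \sum_(F in X) (p \in F : nat)).
  apply: eq_bigr => p _; rewrite /deg -sum1_card [RHS]big_mkcond /=.
  rewrite [LHS]big_mkcond /=; apply: eq_bigr => F _.
  by rewrite inE; case: (F \in X); case: (p \in F).
rewrite exchange_big /= -sum_nat_const; apply: eq_bigr => F /Xt <-.
by rewrite -sum1_card [RHS]big_mkcond; apply: eq_bigr => p _; case: (p \in F).
Qed.

(* Otherwise the transposition of [p] and [q] would inject the members of [X]
   containing [p] but not [q] into those containing [q] but not [p]. *)
Lemma deg_exchange X p q : deg X q < deg X p ->
  exists2 F, F \in X & [/\ p \in F, q \notin F & [set tperm p q x | x in F] \notin X].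
Proof.
move=> ltqp.
suff /exists_inP[F XF /and3P[]] : [exists F in X,
    [&& p \in F, q \notin F & [set tperm p q x | x in F] \notin X]] by exists F.
move: ltqp; apply: contraLR; rewrite negb_exists_in -leqNgt.
move=> /forall_inP noF.
pose s (F : {set T}) := [set tperm p q x | x in F].
have mem_s x F : (x \in s F) = (tperm p q x \in F).
  by rewrite -{1}(tpermK p q x) mem_imset //; apply: perm_inj.
have sI : injective s by apply: imset_inj; apply: perm_inj.
rewrite /deg.
rewrite -(cardsID [set F : {set T} | q \in F] [set F in X | p \in F]).
rewrite -(cardsID [set F : {set T} | p \in F] [set F in X | q \in F]).
rewrite leq_add //.
  apply: subset_leq_card; apply/fintype.subsetP => F; rewrite !inE.
  by move=> /andP[/andP[-> ->] ->].
rewrite -(card_imset _ sI); apply: subset_leq_card.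
apply/fintype.subsetP => _ /imsetP[F + ->]; rewrite !inE !mem_s tpermL tpermR.
move=> /andP[/negP nqF /andP[XF pF]]; have := noF _ XF.
by rewrite pF; move/negP: nqF => -> /=; rewrite negbK andbT.
Qed.

(* A family minimizing the sum of the squared degrees: exchanging two elements
   of degrees differing by at least 2 would decrease the sum. *)
Lemma near_regular_family t k : k <= 'C(#|T|, t) ->
  exists X, [/\ #|X| = k, {in X, forall F : {set T}, #|F| = t} &
    forall p q, deg X p <= (deg X q).+1].
Proof.
move=> k_le.
pose P X := (#|X| == k) && (X \subset [set F : {set T} | #|F| == t]).
have [X0 PX0] : exists X0, P X0.
  have /card_geqP[s [s_uniq s_size s_sub]] : k <= #|[set F : {set T} | #|F| == t]|.
    by rewrite card_draws.
  exists [set F in s]; apply/andP; split.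
    by rewrite cardsE (card_uniqP s_uniq) s_size.
  by apply/fintype.subsetP => F; rewrite inE => /s_sub.
case: (@arg_minnP _ X0 P (fun X => \sum_p deg X p ^ 2) PX0) => X.
move=> /andP[/eqP Xk /fintype.subsetP Xt] minX.
have {}Xt : {in X, forall F : {set T}, #|F| = t} by move=> F /Xt; rewrite inE => /eqP.
exists X; split=> // p q; rewrite leqNgt; apply/negP => ltqp.
have neqp : q != p by apply: contraTneq ltqp => ->; rewrite -leqNgt leqnSn.
have [F XF [pF qF sFX]] := deg_exchange (ltnW ltqp).
set s := [set _ | _ in _] in sFX.
have mem_s x : (x \in s) = (tperm p q x \in F).
  by rewrite -{1}(tpermK p q x) mem_imset //; apply: perm_inj.
pose Y := s |: (X :\ F).
have degY x : deg Y x + (x \in F) = deg X x + (x \in s).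
  rewrite /deg.
  rewrite (cardsD1 F [set G in X | _]) (cardsD1 s [set G in Y | _]) !inE eqxx XF /=.
  rewrite [RHS]addnAC [LHS]addnAC addnC [RHS]addnC; congr (_ + _); last by rewrite addnC.
  congr #|pred_of_set _|; apply/setP => G; rewrite !inE.
  have [->|nGs] /= := eqVneq G s; last by rewrite andbA.
  by rewrite (negPf sFX) !andbF.
have Ycard : #|Y| = k.
  by rewrite -Xk (cardsD1 F X) XF cardsU1 !inE (negPf sFX) andbF.
have PY : P Y.
  rewrite /P Ycard eqxx; apply/fintype.subsetP => G; rewrite !inE.
  case/orP=> [/eqP->|/andP[_ /Xt->] //].
  by rewrite card_imset ?Xt //; apply: perm_inj.
have := minX _ PY; rewrite leqNgt => /negP; apply.
have := degY p; have := degY q; rewrite !mem_s tpermL tpermR pF (negPf qF) => Dq Dp.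
rewrite (bigD1 p) //= (bigD1 q) //=.
rewrite [X in _ < X](bigD1 p) //= [X in _ < _ + X](bigD1 q) //=.
rewrite [X in _ + (_ + X)](eq_bigr (fun x => deg X x ^ 2)); last first.
  move=> x /andP[xp xq]; have := degY x; rewrite mem_s tpermD 1?eq_sym //.
  by move/addIn->.
rewrite !addnA ltn_add2r; nia.
Qed.

(** In a near-regular family, a point avoided by fewer than [k./2] members has degree above
    [uphalf k], so all degrees are at least [uphalf k]. The degree sum then exceeds its value
    [k * t], as [2 * t <= #|T|]. *)
Lemma family_avoiding t k : 2 * t <= #|T| -> k <= 'C(#|T|, t) ->
  exists X, [/\ #|X| = k, {in X, forall F : {set T}, #|F| = t} &
    forall p, k./2 <= #|[set F in X | p \notin F]|].
Proof.
move=> t_le /near_regular_family[X [Xk Xt Xreg]]; exists X; split=> // p.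
have degp : deg X p + #|[set F in X | p \notin F]| = k.
  rewrite -Xk -(cardsID [set F : {set T} | p \in F] X) /deg; congr (_ + _);
  by apply: eq_card => F; rewrite !inE // andbC.
rewrite leqNgt; apply/negP => lt_k.
have degq q : uphalf k <= deg X q by have := Xreg p q; lia.
have : #|T| * uphalf k < \sum_q deg X q.
  rewrite (bigD1 p) //= (cardD1 p) inE /= mulSn -addSn leq_add //; first lia.
  rewrite -sum_nat_const; apply: leq_trans (leq_sum _ _); last by move=> q _; apply: degq.
  rewrite leq_eqVlt; apply/orP; left; apply/eqP; apply: eq_bigl => q.
  by rewrite !inE andbT.
rewrite (sum_deg Xt) Xk; nia.
Qed.

End Regular.

(** * Splicing runs *)

Definition inf_often (P : nat -> Prop) := forall N, exists2 i, N <= i & P i.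

Lemma infinite_natP (P : nat -> Prop) :
  infinite_set [set i | P i]%classic <-> inf_often P.
Proof.
split=> [infP N|ioP].
  apply: contrapT => noi; apply: infP; apply: (@sub_finite_set _ _ `I_N%classic).
    by move=> i Pi /=; rewrite ltnNge; apply/negP => le_Ni; apply: noi; exists i.
  exact: finite_II.
case/finite_seqP => s Es.
have [i le_i Pi] := ioP (\max_(j <- s) j).+1.
have : [set` s]%classic i by rewrite -Es.
by move=> /= /(leq_bigmax_seq (F := id)) /(_ isT); rewrite leqNgt le_i.
Qed.

Lemma uniform_bound (S : finType) (P : S -> nat -> Prop) :
  (forall b, exists i, P b i) -> exists e, forall b, exists2 i, i < e & P b i.
Proof.
case/choice => f Pf; exists (\max_b f b).+1 => b; exists (f b) => //.
by rewrite ltnS leq_bigmax.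
Qed.

Lemma inf_often_pigeonhole (S : finType) (P : S -> nat -> Prop) :
  inf_often (fun i => exists b, P b i) -> exists b, inf_often (P b).
Proof.
move=> ioP; apply: contrapT => nob.
have : forall b, exists N, forall i, P b i -> i < N.
  move=> b; apply: contrapT => noN; apply: nob; exists b => N.
  apply: contrapT => noi; apply: noN; exists N => i Pi.
  by rewrite ltnNge; apply/negP => le_Ni; apply: noi; exists i.
case/choice => f fP; have [i le_i [b /fP]] := ioP (\max_b f b).
by apply/negP; rewrite -leqNgt; apply: leq_trans le_i; apply: leq_bigmax.
Qed.

(** Coding words by sequences of keys turns the mixing of two periodic words into the mixing of two
    constant sequences. *)
Definition block_word (K Sigma : Type) (lett : K -> nat -> Sigma) (N : nat)
    (h : nat -> K) (i : nat) : Sigma :=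
  lett (h (i %/ N)) (i %% N).

Section Splice.
Variables (s s' u u' : nat).
Hypotheses (lt_s : s < s') (lt_u : u < u').

(* The itinerary of a spliced run: follow the first run up to block [s'], then
   alternate between the loop [u, u'] of the second run and the loop [s, s'] of
   the first one.  The boolean tells which run is followed. *)
Definition splice_step (x : bool * nat) : bool * nat :=
  if x.1 then if x.2.+1 == u' then (false, s) else (true, x.2.+1)
  else if x.2.+1 == s' then (true, u) else (false, x.2.+1).

Definition splice (b : nat) := iter b splice_step (false, 0).

Lemma splice_false b c d : splice b = (false, c) -> c + d < s' ->
  splice (b + d) = (false, c + d).
Proof.
move=> bc; elim: d => [|d IH] lt_d; first by rewrite !addn0.
rewrite !addnS /splice iterS -/(splice _) IH; last by lia.
by rewrite /splice_step /= ifF //; lia.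
Qed.

Lemma splice_true b c d : splice b = (true, c) -> c + d < u' ->
  splice (b + d) = (true, c + d).
Proof.
move=> bc; elim: d => [|d IH] lt_d; first by rewrite !addn0.
rewrite !addnS /splice iterS -/(splice _) IH; last by lia.
by rewrite /splice_step /= ifF //; lia.
Qed.

Lemma splice_switch b c : splice b = (false, c) -> c < s' ->
  exists2 b', b <= b' & splice b' = (true, u).
Proof.
move=> bc lt_c; exists (b + (s'.-1 - c)).+1; first by lia.
rewrite /splice iterS -/(splice _) (splice_false bc); last by lia.
by rewrite /splice_step /= ifT //; lia.
Qed.

Lemma splice_return b c : splice b = (true, c) -> c < u' ->
  exists2 b', b <= b' & splice b' = (false, s).
Proof.
move=> bc lt_c; exists (b + (u'.-1 - c)).+1; first by lia.
rewrite /splice iterS -/(splice _) (splice_true bc); last by lia.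
by rewrite /splice_step /= ifT //; lia.
Qed.

Lemma splice_lt b : (splice b).2 < if (splice b).1 then u' else s'.
Proof.
elim: b => [|b] /=; first by lia.
by case: (splice b) => -[] c /= lt_c; rewrite /splice_step /=; case: eqP => /=; lia.
Qed.

Lemma splice_often : inf_often (fun b => splice b = (false, s)) /\
  inf_often (fun b => splice b = (true, u)).
Proof.
have fromfalse : inf_often (fun b => splice b = (false, s)).
  move=> N; have := splice_lt N; case E: (splice N) => [[] c] /= lt_c.
    exact: splice_return E lt_c.
  have [b le_b /splice_return[//|b' le_b']] := splice_switch E lt_c.
  by exists b' => //; lia.
split=> // N; have [b le_b /splice_switch[//|b' le_b']] := fromfalse N.
by exists b' => //; lia.
Qed.

End Splice.

(** Both runs return to [b] at block boundaries, so a loop of [rf] visiting every acceptance set can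
    alternate forever with a loop of [rg]. *)
Lemma pumping (Sigma : finType) (B : ngbw Sigma) (K : Type)
    (lett : K -> nat -> Sigma) (N : nat) (f g : K) (rf rg : nat -> state B)
    (b : state B) : 0 < N ->
  is_run (block_word lett N (fun=> f)) rf -> successful rf ->
  is_run (block_word lett N (fun=> g)) rg ->
  inf_often (fun i => rf (i * N) = b) -> inf_often (fun i => rg (i * N) = b) ->
  exists h : nat -> K,
    [/\ inf_often (fun i => h i = f), inf_often (fun i => h i = g) &
        language B (block_word lett N h)].
Proof.
move=> N_gt0 [rf0 rfS] rfacc [rg0 rgS] iof iog.
have [s _ rfs] := iof 0.
have [e eP] : exists e, forall F : {set state B}, exists2 i, i < e &
    F \in acc B -> s * N <= i /\ rf i \in F.
  apply: uniform_bound => F; have [FB|] := boolP (F \in acc B); last by exists 0.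
  have [q qF /infinite_natP /(_ (s * N))[i le_i rfi]] := rfacc F FB.
  by exists i => _; rewrite rfi.
(* Since [e <= s'], the loop of [rf] from block [s] to block [s'] contains all the visits given by
   [eP]. *)
have [s' le_s' rfs'] := iof (maxn s.+1 e).
have [u _ rgu] := iog 0.
have [u' lt_u rgu'] := iog u.+1.
have lt_s : s < s' by lia.
pose kap := splice s s' u u'.
have [iofalse iotrue] := splice_often lt_s lt_u.
(* The offset [o = N] is meaningful: it is the start of the next block of the same run. *)
pose r (x : bool * nat) o := (if x.1 then rg else rf) (x.2 * N + o).
pose rho i := r (kap (i %/ N)) (i %% N).
pose h j := if (kap j).1 then g else f.
exists h; split.
- by move=> M; have [j le_j Ej] := iofalse M; exists j; rewrite // /h /kap Ej.
- by move=> M; have [j le_j Ej] := iotrue M; exists j; rewrite // /h /kap Ej.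
have r_step x o : o < N ->
    (r x o, lett (if x.1 then g else f) o, r x o.+1) \in trans B.
  move=> lt_o; case: x => [x c]; rewrite /r /= addnS.
  have := rgS (c * N + o); have := rfS (c * N + o).
  by rewrite /block_word modnMDl modn_small //; case: x.
(* When the itinerary switches runs, both sides of the seam are in state [b]. *)
have r_link j : r (kap j) N = r (kap j.+1) 0.
  rewrite /kap /splice iterS -/(splice _ _ _ _ _) /r addn0.
  case: (splice _ _ _ _ j) => [[] c]; rewrite /splice_step /= -mulSnr;
  by case: eqP => [->|//] /=; rewrite ?rfs ?rfs' ?rgu ?rgu'.
exists rho.
  split=> [|i]; first by rewrite /rho div0n mod0n /r /=.
  have lt_o : i %% N < N by rewrite ltn_mod.
  have := r_step (kap (i %/ N)) _ lt_o; rewrite -/(h _) -/(rho i).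
  suff -> : r (kap (i %/ N)) (i %% N).+1 = rho i.+1 by [].
  rewrite /rho {3 4}(divn_eq i N) -addnS.
  have [lt_o1|] := ltnP (i %% N).+1 N.
    by rewrite divnMDl // modnMDl (divn_small lt_o1) addn0 (modn_small lt_o1).
  move=> le_o; have -> : (i %% N).+1 = N by lia.
  by rewrite -mulSnr mulnK // modnMl r_link.
move=> F FB; have [i lt_i /(_ FB)[le_i rfi]] := eP F.
exists (rf i) => //; apply/infinite_natP => M.
have [j le_j Ej] := iofalse M.
have le_si : s <= i %/ N by rewrite leq_divRL.
have lt_is : i %/ N < s'.
  rewrite ltn_divLR //; apply: (@leq_trans s'); first by lia.
  by rewrite leq_pmulr.
have Ei : kap (j + (i %/ N - s)) = (false, i %/ N).
  by rewrite /kap (splice_false lt_s lt_u Ej) subnKC.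
exists ((j + (i %/ N - s)) * N + i %% N); first by nia.
rewrite /rho divnMDl // modnMDl modn_mod (divn_small (ltn_pmod _ _)) //.
by rewrite addn0 Ei /r /= -divn_eq.
Qed.

(** A fooling-set argument: an accepting run for each key repeats some state at block boundaries,
    and two keys sharing that state would give, by [pumping], a forbidden accepted mixture. *)
Lemma card_le_state (Sigma : finType) (B : ngbw Sigma) (K : finType)
    (D : {set K}) (lett : K -> nat -> Sigma) (N : nat) : 0 < N ->
  {in D, forall f : K, language B (block_word lett N (fun=> f))} ->
  {in D &, forall f g : K, f <> g -> forall h,
    inf_often (fun i => h i = f) -> inf_often (fun i => h i = g) ->
    ~ language B (block_word lett N h)} ->
  #|D| <= #|state B|.
Proof.
move=> N_gt0 LD nLD; have [->|[f0 f0D]] := set_0Vmem D; first by rewrite cards0.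
have : forall f : K, exists b : state B, f \in D ->
    exists r : nat -> state B, [/\ is_run (block_word lett N (fun=> f)) r,
      successful r & inf_often (fun i => r (i * N) = b)].
  move=> f; have [fD|_] := boolP (f \in D).
    have [r rrun racc] := LD f fD.
    have [b iob] : exists b, inf_often (fun i => r (i * N) = b).
      by apply: inf_often_pigeonhole => M; exists M => //; exists (r (M * N)).
    by exists b => _; exists r.
  (* Outside [D] any state will do; a run for [f0] supplies one. *)
  by have [r _ _] := LD f0 f0D; exists (r 0).
case/choice => F FP; rewrite -(card_in_imset (f := F)) ?max_card // => f g fD gD Efg.
apply: contrapT => nfg.
have [[rf [rfrun rfacc iof]] [rg [rgrun _ iog]]] := (FP f fD, FP g gD).
rewrite Efg in iof.
have [h [iohf iohg]] := pumping N_gt0 rfrun rfacc rgrun iof iog.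
exact: nLD iohf iohg.
Qed.

(** * The automaton with a hub *)

Section HubAutomaton.
Variable Q : finType.
Implicit Types (p q r v : Q) (t : Q * Q * Q) (X : {set {set Q}}).

(* States are [Some r] for [r : Q], and the hub [None].  The letters
   [(false, (p, v, q))] and [(true, (p, v, q))], read one after the other, keep
   every state of [Q] in place, [v] being parked in the hub meanwhile, and
   moreover allow to go from [p] to [q] through [v]. *)
Definition hub_step (x : option Q) (l : bool * (Q * Q * Q)) (y : option Q) : bool :=
  let: (e, (p, v, q)) := l in
  match x with
  | None => e && (y == Some v)
  | Some r =>
      if e then y == Some (if r == v then q else r)
      else (y == if r == v then None else Some r) || (r == p) && (y == Some v)
  end.

Definition hub_ngbw X : ngbw (bool * (Q * Q * Q))%type :=
  @Ngbw (bool * (Q * Q * Q))%type (option Q)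
    [set x | x != None]%SET
    [set x | hub_step x.1.1 x.1.2 x.2]%SET
    [set [set Some x | x in F] | F : {set Q} in X]%SET.

Definition gadget_word (sigma : nat -> Q * Q * Q) (i : nat) :=
  (odd i, sigma i./2).

Definition allowed (rank : Q -> nat) (J : Q -> {set Q}) (t : Q * Q * Q) : bool :=
  let: (p, v, q) := t in
  (rank q < rank p) || (p == q) && (v \notin J p).

(** Waiting at [r] passes through [r] or the hub, both outside [J r]; an excursion lowers the rank
    or is a loop through some [v] outside [J r]. *)
Lemma gadget_allowed rank (J : Q -> {set Q}) t r y z : r \notin J r -> allowed rank J t ->
  hub_step (Some r) (false, t) y -> hub_step y (true, t) z ->
  exists r', [/\ z = Some r', rank r' <= rank r &
    rank r' = rank r -> forall x, y = Some x -> x \notin J r].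
Proof.
case: t => [[p v] q] /= rJ all_t /orP[/eqP->|/andP[/eqP-> /eqP->]].
  case: (eqVneq r v) => [->|/negPf neq_rv] /= /eqP-> //.
    by exists v.
  by exists r; rewrite neq_rv; split=> // _ x [<-].
rewrite eqxx => /eqP->; exists q.
case/orP: all_t => [lt_q|/andP[/eqP<- vJ]].
  by split=> //; [exact: ltnW | move=> E; rewrite E ltnn in lt_q].
by split=> // _ x [<-].
Qed.

Lemma hub_reject X rank (J : Q -> {set Q}) sigma : injective rank ->
  (forall p, J p \in X) -> (forall p, p \notin J p) ->
  (forall i, allowed rank J (sigma i)) ->
  ~ language (hub_ngbw X) (gadget_word sigma).
Proof.
move=> rankI JX notJ all_sigma [rho [rho0 rhoS] rhoacc].
have step1 i : hub_step (rho i.*2) (false, sigma i) (rho i.*2.+1).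
  by have := rhoS i.*2; rewrite inE /= /gadget_word odd_double doubleK.
have step2 i : hub_step (rho i.*2.+1) (true, sigma i) (rho i.+1.*2).
  by have := rhoS i.*2.+1; rewrite inE /= /gadget_word /= odd_double /= uphalf_double.
have /choice[x rhox] : forall i, exists r, rho i.*2 = Some r.
  elim=> [|i [r rhoi]].
    by move: rho0; rewrite inE double0; case: (rho 0) => // r _; exists r.
  have := step1 i; rewrite rhoi => st1.
  by have [r' [-> _ _]] := gadget_allowed (notJ r) (all_sigma i) st1 (step2 i); exists r'.
have xP i : rank (x i.+1) <= rank (x i) /\ (rank (x i.+1) = rank (x i) ->
    forall v, rho i.*2.+1 = Some v -> v \notin J (x i)).
  have := step1 i; rewrite rhox => st1; have := step2 i; rewrite rhox => st2.
  by have [r' [[<-] le_r H]] := gadget_allowed (notJ _) (all_sigma i) st1 st2; split.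
(* At [N] the rank is least along the run; being nonincreasing and injective, it fixes the state
   from there on. *)
have [N NP] : exists N, forall i, rank (x N) <= rank (x i).
  have ex : exists n, `[< exists i, rank (x i) = n >].
    by exists (rank (x 0)); apply/asboolP; exists 0.
  case: (ex_minnP ex) => n /asboolP[N <-] minN; exists N => i.
  by apply: minN; apply/asboolP; exists i.
have constx i : N <= i -> x i = x N.
  move=> le_i; apply: rankI; apply/eqP; rewrite eqn_leq NP andbT.
  rewrite -(subnKC le_i); elim: (i - N) => [|d IH]; first by rewrite addn0.
  by rewrite addnS (leq_trans (xP _).1).
have [|q qF /infinite_natP /(_ N.*2)[i le_i rhoi]] :=
  rhoacc [set Some y | y in J (x N)]%SET.
  by apply/imsetP; exists (J (x N)).
case/imsetP: qF rhoi => v vJ -> rhoi.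
have le_Ni : N <= i./2 by rewrite -(doubleK N) half_leq.
rewrite -(constx _ le_Ni) in vJ.
(* An odd position is inside a gadget, where [xP] applies; an even one carries the fixed state
   itself. *)
have := odd_double_half i; case: (odd i) => /= Ei; move: rhoi; rewrite -{1}Ei => rhoi.
  have /negP[//] : v \notin J (x i./2).
  by apply: (xP i./2).2 rhoi; rewrite !constx // (leq_trans le_Ni).
by move: rhoi vJ; rewrite add0n rhox => -[->]; apply/negP.
Qed.

(* [D] is an itinerary: the run waits in place for the excursion [D c], makes it
   at its first occurrence, and then waits for [D c.+1]. *)
Lemma hub_accept X (D : nat -> Q * Q * Q) sigma :
  (forall c, (D c).2 = (D c.+1).1.1) ->
  (forall c, inf_often (fun i => sigma i = D c)) ->
  {in X, forall F : {set Q}, inf_often (fun c => (D c).1.2 \in F)} ->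
  language (hub_ngbw X) (gadget_word sigma).
Proof.
move=> chain ioD ioF.
(* [cnt i] is the number of excursions made before gadget [i], hence the index of the one
   awaited. *)
pose cnt := fix cnt i := if i is i'.+1 then
  (if sigma i' == D (cnt i') then (cnt i').+1 else cnt i') else 0.
have cntS i : cnt i.+1 = if sigma i == D (cnt i) then (cnt i).+1 else cnt i by [].
pose pos i := (D (cnt i)).1.1.
pose rho i : option Q := let j := i./2 in
  if odd i then
    if sigma j == D (cnt j) then Some (D (cnt j)).1.2
    else if pos j == (sigma j).1.2 then None else Some (pos j)
  else Some (pos j).
have cnt_le i : cnt i <= i by elim: i => // i; rewrite cntS; case: ifP; lia.
have visit c : exists2 j, cnt j = c & sigma j = D c.
  have next j0 c' : cnt j0 = c' -> exists2 j, cnt j = c' & sigma j = D c'.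
    have [i le_i Ei] := ioD c' j0; rewrite -(subnKC le_i) in Ei.
    move: (i - j0) Ei => d; elim: d j0 {i le_i} => [|d IH] j0 Ei Ec.
      by exists j0; rewrite // -[j0]addn0.
    have [E|/negPf E] := eqVneq (sigma j0) (D c'); first by exists j0.
    by apply: (IH j0.+1); [rewrite addSnnS | rewrite cntS Ec E].
  elim: c => [|c [j Ej sj]]; first exact: (next 0).
  by apply: (next j.+1); rewrite cntS Ej sj eqxx.
exists rho.
  split=> [|i]; first by rewrite inE.
  rewrite inE /= /rho /gadget_word.
  have hi : i.+1./2 = odd i + i./2 by rewrite -uphalfE uphalf_half.
  rewrite hi /=; case: (odd i) => /=; rewrite ?add0n ?add1n.
    rewrite /pos cntS; case: (sigma _ =P _) => [->|_].
      by rewrite -chain; case: (D _) => [[p v] q] /=; rewrite !eqxx.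
    case: (sigma i./2) => [[p v] q] /=.
    by case: eqP => [->|/eqP/negPf ->]; rewrite eqxx.
  case: (sigma _ =P _) => [->|_].
    by rewrite /pos; case: (D _) => [[p v] q] /=; rewrite !eqxx orbT.
  case: (sigma i./2) => [[p v] q] /=.
  by rewrite eqxx.
move=> _ /imsetP[F FX ->].
have [q ioq] : exists q : option Q,
    inf_often (fun i => q \in [set Some x | x in F]%SET /\ rho i = q).
  apply: inf_often_pigeonhole => N; have [c le_c cF] := ioF F FX N.
  have [j Ej sj] := visit c; exists j.*2.+1.
    by have := cnt_le j; lia.
  exists (rho j.*2.+1); split=> //.
  rewrite /rho /= odd_double /= uphalf_double Ej sj eqxx.
  by apply: imset_f.
exists q; first by have [i _ []] := ioq 0.
by apply/infinite_natP => N; have [i le_i [_ E]] := ioq N; exists i.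
Qed.

End HubAutomaton.

(** * Cyclic enumerations and inversions of permutations *)

Definition enum_cycle (T : finType) (x0 : T) (W : {set T}) (c : nat) : T :=
  nth x0 (enum W) (c %% #|W|).

Lemma mem_enum_cycle (T : finType) (x0 : T) (W : {set T}) c :
  x0 \in W -> enum_cycle x0 W c \in W.
Proof.
move=> x0W; rewrite -mem_enum mem_nth // -cardE ltn_mod card_gt0.
by apply/set0Pn; exists x0.
Qed.

Lemma enum_cycle_often (T : finType) (x0 : T) (W : {set T}) v : v \in W ->
  inf_often (fun c => enum_cycle x0 W c = v).
Proof.
move=> vW N; have lt_v : index v (enum W) < #|W| by rewrite cardE index_mem mem_enum.
exists (N * #|W| + index v (enum W)); first by nia.
by rewrite /enum_cycle modnMDl modn_small // nth_index ?mem_enum.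
Qed.

Lemma perm_rank m (s : {perm 'I_m}) p : #|[set q | s q < s p]%SET| = s p.
Proof.
rewrite -sum1_card (eq_bigl (fun q => s q < s p)); last by move=> q; rewrite inE.
transitivity (\sum_(j < m | j < s p) 1).
  by rewrite [RHS](reindex_inj (@perm_inj _ s)).
by rewrite -(big_ord_widen m (fun=> 1)) ?sum1_card ?card_ord // ltnW.
Qed.

(** A permutation is recovered from the order it induces, by [perm_rank], so two permutations
    without a discordant pair coincide. *)
Lemma perm_inversion m (s s' : {perm 'I_m}) : s <> s' ->
  exists p q, s q < s p /\ s' p < s' q.
Proof.
move=> neq; apply: contrapT => noinv; apply: neq; apply/permP => p.
have mono (u v : {perm 'I_m}) r q :
    ~ (exists p q, u q < u p /\ v p < v q) -> u q < u r -> v q < v r.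
  move=> noi lt_u; rewrite ltnNge; apply/negP; rewrite leq_eqVlt => /orP[/eqP E|lt_v].
    by rewrite (perm_inj (val_inj E)) ltnn in lt_u.
  by apply: noi; exists r, q.
apply: val_inj; rewrite /= -(perm_rank s p) -(perm_rank s' p).
apply: eq_card => q; rewrite !inE; apply/idP/idP; apply: mono => //.
by move=> [a [b [? ?]]]; apply: noinv; exists b, a.
Qed.

(** * Level rankings *)

Section Fooling.
Variable m : nat.
Notation Q := 'I_m.
Notation triple := (Q * Q * Q)%type.
(* The ranks of the states, and the acceptance set assigned to each of them. *)
Notation ranking := ({perm Q} * {ffun Q -> {set Q}})%type.
Implicit Types (f g : ranking) (X : {set {set Q}}) (t : triple).

Definition ranking_allows f t := allowed (fun p => f.1 p) f.2 t.

(* The triple [(p, p, p)] is allowed by all admissible rankings. *)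
Definition filter_triple f t : triple :=
  if ranking_allows f t then t else (t.1.1, t.1.1, t.1.1).

(** A block runs through all triples, filtered by [f], so its length does not depend on [f]; [t0] is
    only the default of [nth]. *)
Definition letter (t0 : triple) f (o : nat) : bool * triple :=
  (odd o, filter_triple f (enum_cycle t0 [set: triple] o./2)).

Definition period := #|[set: triple]%SET| * 2.

Definition admissible X : {set ranking} :=
  [set f : ranking | [forall p, (f.2 p \in X) && (p \notin f.2 p)]]%SET.

Lemma admissibleP X f : f \in admissible X ->
  (forall p, f.2 p \in X) /\ (forall p, p \notin f.2 p).
Proof. by rewrite inE => /forallP fX; split=> p; case/andP: (fX p). Qed.

Lemma block_word_gadget t0 (h : nat -> ranking) :
  block_word (letter t0) period h = gadget_word (fun j =>
    filter_triple (h (j %/ #|[set: triple]%SET|)) (enum_cycle t0 [set: triple] j)).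
Proof.
apply/funext => i; rewrite /block_word /letter /gadget_word /period; congr (_, _).
  have := modn_dvdm i (dvdn_mull #|[set: triple]%SET| (dvdnn 2)).
  by rewrite !modn2; do 2 case: odd.
rewrite mulnC divnMA divn2; congr (filter_triple _ _).
rewrite /enum_cycle -!divn2; congr nth.
by rewrite mulnC -modn_divl modn_mod.
Qed.

Lemma card_admissible X k : (forall p, k <= #|[set F in X | p \notin F]%SET|) ->
  m`! * k ^ m <= #|admissible X|.
Proof.
move=> kX.
have -> : admissible X = finset.setX [set: {perm Q}]
    [set g in family (fun p => [pred F in X | p \notin F])]%SET.
  by apply/setP => -[s g]; rewrite !inE; apply: eq_forallb => p; rewrite inE.
rewrite cardsX cardsT card_Sn leq_mul2l; apply/orP; right.
rewrite cardsE card_family.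
have -> : k ^ m = k ^ size (enum 'I_m) by rewrite size_enum_ord.
rewrite /image_mem; elim: (enum 'I_m) => //= p s IH.
rewrite expnS leq_mul //; apply: leq_trans (kX p) _.
by rewrite cardsE.
Qed.

Lemma const_rejected X t0 f : f \in admissible X ->
  ~ language (hub_ngbw X) (block_word (letter t0) period (fun=> f)).
Proof.
case/admissibleP => fX fp; rewrite block_word_gadget.
apply: (hub_reject (rank := fun p => f.1 p) (J := f.2)) => //.
  by move=> p q /val_inj /perm_inj.
move=> i; rewrite /filter_triple; case: ifP => // _.
by case: (enum_cycle _ _ _) => [[p v] q] /=; rewrite eqxx fp orbT.
Qed.

Lemma mixed_accepted X (t : nat) t0 f g (h : nat -> ranking) : 0 < t ->
  {in X, forall F : {set Q}, #|F| = t} ->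
  f \in admissible X -> g \in admissible X -> f <> g ->
  inf_often (fun i => h i = f) -> inf_often (fun i => h i = g) ->
  language (hub_ngbw X) (block_word (letter t0) period h).
Proof.
move=> t_gt0 Xt /admissibleP[fX fp] /admissibleP[gX gp] neq_fg iof iog.
rewrite block_word_gadget; set sigma := (X in gadget_word X).
have M_gt0 : 0 < #|[set: triple]%SET|.
  by rewrite card_gt0; apply/set0Pn; exists t0; rewrite inE.
have often e u : inf_often (fun i => h i = e) -> ranking_allows e u ->
    inf_often (fun i => sigma i = u).
  move=> ioe eu N; have [b le_b hb] := ioe N.
  have lt_u : index u (enum [set: triple]%SET) < #|[set: triple]%SET|.
    by rewrite cardE index_mem mem_enum inE.
  exists (b * #|[set: triple]%SET| + index u (enum [set: triple]%SET)); first by nia.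
  rewrite /sigma divnMDl // divn_small // addn0 hb /enum_cycle modnMDl modn_small //.
  by rewrite nth_index ?mem_enum ?inE // /filter_triple eu.
have [eq1|neq1] := pselect (f.1 = g.1).
  have [p neqp] : exists p, f.2 p != g.2 p.
    apply: contrapT => nop; apply: neq_fg; case: f g eq1 nop {iof iog fX fp gX gp}.
    move=> f1 f2 [g1 g2] /= -> nop; congr (_, _); apply/ffunP => p.
    by apply: contrapT => /eqP np; apply: nop; exists p.
  (* [W] collects the [v] for which [f] or [g] allows the loop [(p, v, p)]. It meets each [F] in
     [X]: sets in [X] have equal size, so [F] cannot lie in two distinct ones. *)
  pose W := (~: (f.2 p :&: g.2 p))%SET.
  have pW : p \in W by rewrite !inE negb_and fp.
  apply: (hub_accept (D := fun c => (p, enum_cycle p W c, p))) => //.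
    move=> c; have := mem_enum_cycle c pW; rewrite !inE negb_and => /orP[fv|gv].
      by apply: (often f) => //; rewrite /ranking_allows /= eqxx fv orbT.
    by apply: (often g) => //; rewrite /ranking_allows /= eqxx gv orbT.
  move=> F FX; suff /fintype.subsetPn[v vF] : ~~ (F \subset f.2 p :&: g.2 p).
    rewrite -finset.in_setC => /(enum_cycle_often p) io N.
    by have [c le_c Ec] := io N; exists c; rewrite //= Ec.
  apply: contra neqp; rewrite finset.subsetI => /andP[Ff Fg].
  have eqF (G : {set Q}) : G \in X -> F \subset G -> F = G.
    by move=> GX FG; apply/eqP; rewrite eqEcard FG !Xt /=.
  by rewrite -(eqF _ (fX p) Ff) -(eqF _ (gX p) Fg).
(* Going from [p] to [q] through any state is allowed by [f], and the way back by [g]. *)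
have [p [q [lt_f lt_g]]] := perm_inversion neq1.
apply: (hub_accept (D := fun c => if odd c then (q, p, p)
    else (p, enum_cycle p [set: Q] c./2, q))) => [c|c|F FX N] /=.
- by case: (odd c).
- case: (odd c); first by apply: (often g); rewrite /ranking_allows /= ?lt_g.
  by apply: (often f); rewrite /ranking_allows /= ?lt_f.
have /card_gt0P[v vF] : 0 < #|F| by rewrite Xt.
have [c le_c Ec] := enum_cycle_often p (finset.in_setT v) N.
by exists c.*2; [lia | rewrite /= odd_double doubleK /= Ec].
Qed.

Lemma complement_lower_bound X (t : nat) k (B : ngbw (bool * triple)%type) : 0 < m ->
  0 < t -> {in X, forall F : {set Q}, #|F| = t} ->
  (forall p, k <= #|[set F in X | p \notin F]%SET|) ->
  language B = (~` language (hub_ngbw X))%classic -> m`! * k ^ m <= #|state B|.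
Proof.
move=> m_gt0 t_gt0 Xt kX LB; apply: leq_trans (card_admissible kX) _.
pose p0 := Ordinal m_gt0.
apply: (@card_le_state _ B _ (admissible X) (letter (p0, p0, p0)) period).
- by rewrite muln_gt0 card_gt0 andbT; apply/set0Pn; exists (p0, p0, p0); rewrite inE.
- by move=> f fX; rewrite LB; apply: const_rejected.
- move=> f g fX gX neq h iof iog; rewrite LB => -[].
  exact: mixed_accepted t_gt0 Xt fX gX neq iof iog.
Qed.

End Fooling.

(** * The lower bound *)

Import Order.TTheory GRing.Theory Num.Theory.
Local Open Scope ring_scope.

Theorem theorem5p10 (R : realType) :
  exists2 c : R, 0 < c &
    forall n k : nat, (1 < n)%N -> (1 < k <= 'C(n.-1, n.-1./2))%N ->
      (((c * n%:R * k%:R) ^+ n)%:E <= C_NGBW R n k)%E.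
Proof.
exists 48%:R^-1; first by rewrite invr_gt0 ltr0n.
case=> [//|m] k _ /= /andP[k_gt1 k_le].
(* If [m./2] were 0, the binomial bounding [k] would be 1. *)
have t_gt0 : (0 < m./2)%N.
  rewrite lt0n; apply: contraTneq k_gt1 => t0.
  by rewrite -leqNgt (leq_trans k_le) ?t0 ?bin0.
have [X [Xk Xt kX]] : exists X : {set {set 'I_m}}, [/\ #|X| = k,
    {in X, forall F : {set 'I_m}, #|F| = m./2} &
    forall p, (k./2 <= #|[set F in X | p \notin F]%SET|)%N].
  by apply: family_avoiding; rewrite card_ord //; lia.
apply: (@le_trans _ _ (C_NGBW_of R (hub_ngbw X))); last first.
  apply: ereal_sup_ubound; exists _, (hub_ngbw X); split=> //.
    by rewrite card_option card_ord.
  rewrite /ngbw_index /= card_imset //; apply: imset_inj; exact: Some_inj.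
apply: le_ereal_inf_tmp => _ [B LB ->]; rewrite lee_fin.
have m_gt0 : (0 < m)%N by lia.
have le_B := complement_lower_bound m_gt0 t_gt0 Xt kX LB.
have le_nat : ((m.+1 * k) ^ m.+1 <= 48 ^ m.+1 * #|state B|)%N.
  apply: leq_trans (expn_nk_le (m := m) _) _.
    by rewrite k_gt1 (leq_trans k_le (bin_le_expn _ _)).
  by rewrite leq_mul2l; apply/orP; right.
rewrite -mulrA exprMn exprVn mulrC ler_pdivrMr ?exprn_gt0 ?ltr0n //.
by rewrite -natrM -!natrX -natrM ler_nat [leqRHS]mulnC.
Qed.
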